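(* There exists a polynomial-time algorithm that, given an instance of Colored Subgraph Isomorphism whose pattern graph $H$ is a cubic graph on $k$ vertices (hence with $m=3k/2$ edges) and whose host graph $G$ has $k\cdot n$ vertices, outputs an equivalent instance of Restricted Vector $k$-Sum with parameters $m,k,n$.
   Context: Colored Subgraph Isomorphism: given a pattern graph $H$ with $k$ vertices, a host graph $G$ with $k\cdot n$ vertices, and a function $f\colon V(G)\to V(H)$ with $|f^{-1}(h)|=n$ for all $h\in V(H)$, decide whether there is a subgraph $G'$ of $G$ such that $f|_{V(G')}$ is an isomorphism from $G'$ to $H$. A graph is cubic if every vertex has degree exactly $3$. Vector $k$-Sum: given $k$ lists $A_1,\dots,A_k$ of $m$-dimensional integer vectors and a target $t\in\mathbb{Z}^m$, decide whether there are $a_1\in A_1,\dots,a_k\in A_k$ with $\sum_i a_i=t$. For $a\in\mathbb{Z}^m$, $a[j]$ denotes its $j$-th entry. A list $A$ of $m$-dimensional vectors is node-representing with parameters $m,n$ if there are disjoint $D^+,D^-\subseteq\{1,\dots,m\}$ with $|D^+|+|D^-|=3$ such that for all $a\in A$ and $j\in[m]$: $a[j]\in[1,n^2]$ if $j\in D^+$, $a[j]\in[-n^2,-1]$ if $j\in D^-$, and $a[j]=0$ otherwise; the elements of $D^+\cup D^-$ are the non-zero dimensions of $A$. A Restricted Vector $k$-Sum instance with parameters $m,k,n$ is a Vector $k$-Sum instance in which: (1) the target is $0\in\mathbb{Z}^m$; (2) there are $k$ lists, each of size exactly $n^4$; (3) every list is node-representing with parameters $m,n$; (4) each $j\in[m]$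 is a non-zero dimension in exactly two of the $k$ lists. Two instances are equivalent if both are yes-instances or both are no-instances. *)

(* Defs.v *)
From mathcomp Require Import all_boot all_order all_algebra.

Set Implicit Arguments.
Unset Strict Implicit.
Unset Printing Implicit Defensive.

(** * Graphs *)

Record sgraph (V : finType) := SGraph {
  adj : rel V;
  adj_sym : symmetric adj;
  adj_irr : irreflexive adj }.

Definition edges (V : finType) (G : sgraph V) : {set {set V}} :=
  [set [set p.1; p.2] | p in [set p : V * V | adj G p.1 p.2]].

Definition cubic (V : finType) (G : sgraph V) : Prop :=
  forall x : V, #|[set y | adj G x y]| = 3.

(* Subgraphs need not be induced. *)
Record subgraph (V : finType) (G : sgraph V) := Subgraph {
  sub_verts : {set V};
  sub_adj : rel V;
  sub_sym : symmetric sub_adj;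
  sub_incl : forall x y, sub_adj x y ->
    [/\ adj G x y, x \in sub_verts & y \in sub_verts] }.

Definition iso_on (V W : finType) (G : sgraph V) (G' : subgraph G)
    (H : sgraph W) (f : V -> W) : Prop :=
  [/\ {in sub_verts G' &, injective f},
      f @: sub_verts G' = [set: W]
    & {in sub_verts G' &, forall x y, adj H (f x) (f y) = sub_adj G' x y}].

(** * Colored Subgraph Isomorphism *)

Record csi_instance (k n : nat) := CSI {
  pattern : sgraph 'I_k;
  host : sgraph 'I_(k * n);
  color : 'I_(k * n) -> 'I_k;
  color_fibre : forall h : 'I_k, #|[set v | color v == h]| = n }.

Definition csi_yes (k n : nat) (I : csi_instance k n) : Prop :=
  exists G' : subgraph (host I), iso_on G' (pattern I) (@color k n I).

(** * Vector k-Sum *)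

Record vksum_instance (m k : nat) := VKSum {
  lists : 'I_k -> seq 'rV[int]_m;
  target : 'rV[int]_m }.

Definition vksum_yes (m k : nat) (J : vksum_instance m k) : Prop :=
  exists a : 'I_k -> 'rV[int]_m,
    (forall i, a i \in lists J i) /\ (\sum_(i < k) a i)%R = target J.

(* [A] is node-representing, as witnessed by [Dp] and [Dm]. *)
Definition node_representing (m n : nat) (Dp Dm : {set 'I_m})
    (A : seq 'rV[int]_m) : Prop :=
  [/\ [disjoint Dp & Dm],
      #|Dp| + #|Dm| = 3
    & forall (a : 'rV[int]_m) (j : 'I_m), a \in A ->
      [/\ j \in Dp -> (1 <= a ord0 j <= (n ^ 2)%:Z)%R,
          j \in Dm -> (- (n ^ 2)%:Z <= a ord0 j <= -1)%R
        & j \notin Dp :|: Dm -> a ord0 j = 0%R]].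

(* The witnesses are determined by the lists unless these are empty (n = 0). *)
Definition restricted (m k n : nat) (J : vksum_instance m k) : Prop :=
  [/\ target J = 0%R,
      forall i, size (lists J i) = n ^ 4
    & exists Dp Dm : 'I_k -> {set 'I_m},
        (forall i, node_representing n (Dp i) (Dm i) (lists J i)) /\
        (forall j, #|[set i | j \in Dp i :|: Dm i]| = 2)].

(** * Algorithms *)

(* Random access machines in the style of Aho, Hopcroft and Ullman, over
   structured programs: a memory of natural numbers with indirect addressing,
   a read-only input and a write-only output.  Every operation is charged the
   bit lengths of the addresses and values it handles (logarithmic cost), so
   that polynomial time coincides with polynomial time on Turing machines. *)

Definition bits (v : nat) : nat := (trunc_log 2 v).+1.

Inductive binop := Add | Sub | Mul | Div.

Inductive expr :=
  | Const of nat
  | Mem of expr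
  | In of expr
  | InSize
  | Op of binop & expr & expr.

Inductive prog :=
  | Skip
  | Store of expr & expr
  | Write of expr
  | Seq of prog & prog
  | If of expr & prog & prog
  | While of expr & prog.

Definition apply_op (o : binop) : nat -> nat -> nat :=
  match o with Add => addn | Sub => subn | Mul => muln | Div => divn end.

Fixpoint eval (x : seq nat) (mu : nat -> nat) (e : expr) : nat :=
  match e with
  | Const c => c
  | Mem e1 => mu (eval x mu e1)
  | In e1 => nth 0 x (eval x mu e1)
  | InSize => size x
  | Op o e1 e2 => apply_op o (eval x mu e1) (eval x mu e2)
  end.

Fixpoint cost (x : seq nat) (mu : nat -> nat) (e : expr) : nat :=
  match e with
  | Const _ | InSize => bits (eval x mu e)
  | Mem e1 | In e1 => cost x mu e1 + bits (eval x mu e1) + bits (eval x mu e)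
  | Op _ e1 e2 => cost x mu e1 + cost x mu e2
                  + bits (eval x mu e1) + bits (eval x mu e2)
  end.

Definition upd (mu : nat -> nat) (a v : nat) : nat -> nat :=
  fun b => if b == a then v else mu b.

(* [exec x P mu o t mu' o']: on input [x], from memory [mu] and output [o],
   [P] halts after time [t] with memory [mu'] and output [o']. *)
Inductive exec (x : seq nat) :
  prog -> (nat -> nat) -> seq nat -> nat -> (nat -> nat) -> seq nat -> Prop :=
  | exec_skip mu o : exec x Skip mu o 1 mu o
  | exec_store a e mu o :
      exec x (Store a e) mu o
        (cost x mu a + cost x mu e + bits (eval x mu a) + bits (eval x mu e))
        (upd mu (eval x mu a) (eval x mu e)) o
  | exec_write e mu o :
      exec x (Write e) mu o (cost x mu e + bits (eval x mu e))
        mu (rcons o (eval x mu e))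
  | exec_seq P Q mu o t mu1 o1 u mu2 o2 :
      exec x P mu o t mu1 o1 -> exec x Q mu1 o1 u mu2 o2 ->
      exec x (Seq P Q) mu o (t + u) mu2 o2
  | exec_if e P Q mu o t mu1 o1 :
      exec x (if eval x mu e != 0 then P else Q) mu o t mu1 o1 ->
      exec x (If e P Q) mu o (cost x mu e + t) mu1 o1
  | exec_while_stop e P mu o :
      eval x mu e = 0 -> exec x (While e P) mu o (cost x mu e) mu o
  | exec_while_step e P mu o t mu1 o1 u mu2 o2 :
      eval x mu e != 0 ->
      exec x P mu o t mu1 o1 -> exec x (While e P) mu1 o1 u mu2 o2 ->
      exec x (While e P) mu o (cost x mu e + t + u) mu2 o2.

Definition outputs_within (P : prog) (x y : seq nat) (T : nat) : Prop :=
  exists t mu, t <= T /\ exec x P (fun=> 0) [::] t mu y.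

Definition bitsize (x : seq nat) : nat := sumn (map bits x).

(** * Encodings of instances *)

Definition encode_adj (N : nat) (G : sgraph 'I_N) : seq nat :=
  [seq nat_of_bool (adj G u v) | u <- enum 'I_N, v <- enum 'I_N].

Definition encode_csi (k n : nat) (I : csi_instance k n) : seq nat :=
  [:: k; n] ++ encode_adj (pattern I) ++ encode_adj (host I)
  ++ [seq nat_of_ord (@color k n I v) | v <- enum 'I_(k * n)].

Definition encode_int (z : int) : seq nat := [:: nat_of_bool (z < 0)%R; `|z|%N].

Definition encode_vec (m : nat) (a : 'rV[int]_m) : seq nat :=
  flatten [seq encode_int (a ord0 j) | j <- enum 'I_m].

Definition encode_list (m : nat) (A : seq 'rV[int]_m) : seq nat :=
  size A :: flatten (map (@encode_vec m) A).

Definition encode_vksum (m k : nat) (J : vksum_instance m k) : seq nat :=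
  [:: m; k] ++ encode_vec (target J)
  ++ flatten [seq encode_list (lists J i) | i <- enum 'I_k].

(* Main.v *)
(** The list of a pattern vertex [h] ranges over the [n ^ 4] choices of a vertex
    of colour [h] together with one vertex in each of the three neighbouring
    colour classes.  The dimension of an edge [a < b] carries the number of the
    chosen pair in [1, n ^ 2], positively in the list of [a] and negatively in
    that of [b], so that the sum vanishes exactly when both lists agree on the
    pair.  A choice using a non-edge of the host is replaced by the first
    admissible choice of the same list; if some list has no admissible choice,
    there is no solution, and making all entries positive yields a
    no-instance.

    The output is an arithmetic expression of the input built from bounded
    sums and bounded loops.  Such expressions have polynomially bounded values,
    and by induction on the expression they compile to random access programs
    running in polynomial time. *)

Require Import Defs.
From mathcomp Require Import all_boot all_order all_algebra.
From mathcomp Require Import zify.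

Set Implicit Arguments.
Unset Strict Implicit.
Unset Printing Implicit Defensive.

(** * Expressions with bounded sums, and their compilation *)

Inductive term :=
  | TConst of nat
  | TVar of nat
  | TIn of term
  | TOp of binop & term & term
  | TSum of nat & term & term.

Fixpoint den (x : seq nat) (env : nat -> nat) (e : term) : nat :=
  match e with
  | TConst c => c
  | TVar i => env i
  | TIn e1 => nth 0 x (den x env e1)
  | TOp o e1 e2 => apply_op o (den x env e1) (den x env e2)
  | TSum i e1 e2 => \sum_(j < den x env e1) den x (upd env i j) e2
  end.

Inductive outp :=
  | OWrite of term
  | OSeq of outp & outp
  | OFor of nat & term & outp.

Fixpoint oden (x : seq nat) (env : nat -> nat) (p : outp) : seq nat :=
  match p with
  | OWrite e => [:: den x env e]
  | OSeq p1 p2 => oden x env p1 ++ oden x env p2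
  | OFor i e p1 =>
      flatten [seq oden x (upd env i j) p1 | j <- iota 0 (den x env e)]
  end.

(* Variables live at even addresses, temporaries at odd ones. *)
Definition vreg (i : nat) : nat := i.*2.
Definition treg (l : nat) : nat := l.*2.+1.

Definition rd (a : nat) : expr := Defs.Mem (Const a).
Definition assign (a : nat) (e : expr) : prog := Store (Const a) e.

(* The bound of the loop sits in temporary [l]; temporary [l.+1] saves the
   loop variable. *)
Definition for_loop (i l : nat) (body : prog) : prog :=
  Seq (assign (treg l.+1) (rd (vreg i)))
    (Seq (assign (vreg i) (Const 0))
      (Seq (While (Op Defs.Sub (rd (treg l)) (rd (vreg i)))
             (Seq body (assign (vreg i) (Op Add (rd (vreg i)) (Const 1)))))
         (assign (vreg i) (rd (treg l.+1))))).

(** The value ends up in temporary [l]. In a sum, temporary [l] holds the bound, [l.+1] the saved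
    loop variable and [l.+2] the partial sum; the summand works from [l.+3] on. *)
Fixpoint comp (e : term) (l : nat) : prog :=
  match e with
  | TConst c => assign (treg l) (Const c)
  | TVar i => assign (treg l) (rd (vreg i))
  | TIn e1 => Seq (comp e1 l) (assign (treg l) (In (rd (treg l))))
  | TOp o e1 e2 =>
      Seq (comp e1 l) (Seq (comp e2 l.+1)
        (assign (treg l) (Op o (rd (treg l)) (rd (treg l.+1)))))
  | TSum i e1 e2 =>
      Seq (comp e1 l) (Seq (assign (treg l.+2) (Const 0))
        (Seq (for_loop i l (Seq (comp e2 l.+3)
               (assign (treg l.+2)
                  (Op Add (rd (treg l.+2)) (rd (treg l.+3))))))
           (assign (treg l) (rd (treg l.+2)))))
  end.

Fixpoint ocomp (p : outp) (l : nat) : prog :=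
  match p with
  | OWrite e => Seq (comp e l) (Write (rd (treg l)))
  | OSeq p1 p2 => Seq (ocomp p1 l) (ocomp p2 l)
  | OFor i e p1 => Seq (comp e l) (for_loop i l (ocomp p1 l.+2))
  end.

Definition vars (mu : nat -> nat) (i : nat) : nat := mu (vreg i).

(* Only temporaries from [l] on may differ. *)
Definition agree (l : nat) (mu mu' : nat -> nat) : Prop :=
  forall a, ~~ odd a || (a < treg l) -> mu' a = mu a.

Lemma agree_trans l mu1 mu2 mu3 :
  agree l mu1 mu2 -> agree l mu2 mu3 -> agree l mu1 mu3.
Proof. by move=> H1 H2 a Ha; rewrite H2 // H1. Qed.

Lemma agreeW l l' mu1 mu2 : l <= l' -> agree l' mu1 mu2 -> agree l mu1 mu2.
Proof. by move=> Hl H a Ha; apply: H; move: Ha; rewrite /treg; lia. Qed.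

Lemma agree_upd l a v mu : odd a -> treg l <= a -> agree l mu (upd mu a v).
Proof. by move=> Ha Hl b Hb; rewrite /upd; case: eqP => // E; lia. Qed.

Lemma agree_treg l l' mu1 mu2 :
  l' < l -> agree l mu1 mu2 -> mu2 (treg l') = mu1 (treg l').
Proof. by move=> Hl; apply; rewrite /treg; lia. Qed.

Lemma agree_vreg l i mu1 mu2 : agree l mu1 mu2 -> mu2 (vreg i) = mu1 (vreg i).
Proof. by apply; rewrite /vreg odd_double. Qed.

Lemma odd_treg l : odd (treg l).
Proof. by rewrite /treg /= odd_double. Qed.

Lemma treg_vreg i l : (treg l == vreg i) = false.
Proof. by rewrite /vreg /treg; lia. Qed.

Lemma eq_treg l l' : (treg l == treg l') = (l == l').
Proof. by rewrite /treg; lia. Qed.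

Lemma eq_vreg i j : (vreg i == vreg j) = (i == j).
Proof. by rewrite /vreg; lia. Qed.

Lemma bits_le v : bits v <= v.+1.
Proof.
rewrite /bits ltnS; case: v => // v.
have := trunc_logP (isT : 1 < 2) (ltn0Sn v).
by move/(leq_trans (ltnW (ltn_expl _ (isT : 1 < 2)))).
Qed.

Lemma eq_den x e env1 env2 : env1 =1 env2 -> den x env1 e = den x env2 e.
Proof.
elim: e env1 env2 => //= [e IH|o e1 IH1 e2 IH2|i e1 IH1 e2 IH2] env1 env2 E.
- by rewrite (IH _ _ E).
- by rewrite (IH1 _ _ E) (IH2 _ _ E).
- rewrite (IH1 _ _ E); apply: eq_bigr => j _; apply: IH2 => b.
  by rewrite /upd; case: eqP.
Qed.

Lemma eq_oden x p env1 env2 : env1 =1 env2 -> oden x env1 p = oden x env2 p.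
Proof.
elim: p env1 env2 => /= [e|p1 IH1 p2 IH2|i e p IH] env1 env2 E.
- by rewrite (eq_den x e E).
- by rewrite (IH1 _ _ E) (IH2 _ _ E).
- rewrite (eq_den x e E); congr flatten; apply: eq_map => j; apply: IH => b.
  by rewrite /upd; case: eqP.
Qed.

Lemma exec_assign x a e mu o v :
  eval x mu e = v ->
  exec x (assign a e) mu o (bits a + cost x mu e + bits a + bits v)
    (upd mu a v) o.
Proof. by move=> <-; apply: exec_store. Qed.

(** Induction on the number [r] of iterations left. Before iteration [j] the memory is [mu] with
    loop variable [j], up to temporaries from [l.+2] on; [R] is an invariant relating [j], the
    accumulator and the output. The summand with factor 40 pays for test and increment. *)
Lemma exec_while_loop x i l body mu N T (R : nat -> nat -> seq nat -> Prop) :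
  mu (treg l) = N ->
  (forall j mu1 o1, j < N -> agree l.+2 (upd mu (vreg i) j) mu1 ->
     R j (mu1 (treg l.+2)) o1 ->
     exists t mu2 o2, [/\ exec x body mu1 o1 t mu2 o2, t <= T,
       agree l.+2 mu1 mu2 & R j.+1 (mu2 (treg l.+2)) o2]) ->
  forall r j mu1 o1, j + r = N -> agree l.+2 (upd mu (vreg i) j) mu1 ->
  R j (mu1 (treg l.+2)) o1 ->
  exists t mu2 o2,
    [/\ exec x (While (Op Defs.Sub (rd (treg l)) (rd (vreg i)))
             (Seq body (assign (vreg i) (Op Add (rd (vreg i)) (Const 1)))))
          mu1 o1 t mu2 o2,
        t <= r.+1 * (T + 40 * (N + l + i).+1),
        agree l.+2 (upd mu (vreg i) N) mu2
      & R N (mu2 (treg l.+2)) o2].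
Proof.
move=> HN Hbody.
have vE mu1 j : agree l.+2 (upd mu (vreg i) j) mu1 -> mu1 (vreg i) = j.
  by move=> H; rewrite (agree_vreg i H) /upd eqxx.
have tE mu1 j : agree l.+2 (upd mu (vreg i) j) mu1 -> mu1 (treg l) = N.
  by move=> H; rewrite (agree_treg _ H) // /upd treg_vreg.
have bt := bits_le (treg l); have bv := bits_le (vreg i).
have bN := bits_le N.
elim=> [|r IH] j mu1 o1 Hjr Hag HR.
  exists (cost x mu1 (Op Defs.Sub (rd (treg l)) (rd (vreg i)))), mu1, o1.
  have ej : j = N by lia.
  subst j; split=> //.
    by apply: exec_while_stop; rewrite /= (vE _ _ Hag) (tE _ _ Hag) subnn.
  rewrite /= (vE _ _ Hag) (tE _ _ Hag) /treg /vreg.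
  rewrite /treg /vreg in bv bt *.
  lia.
have jN : j < N by lia.
have [t [mu2 [o2 [He Ht Hag2 HR2]]]] := Hbody j mu1 o1 jN Hag HR.
have v1 := vE _ _ Hag; have t1 := tE _ _ Hag.
have v2 : mu2 (vreg i) = j by rewrite (agree_vreg i Hag2) v1.
pose mu3 := upd mu2 (vreg i) j.+1.
have Hag3 : agree l.+2 (upd mu (vreg i) j.+1) mu3.
  move=> a Ha; rewrite /mu3 /upd; case: eqP => // /eqP na.
  by rewrite (Hag2 a Ha) (Hag a Ha) /upd (negbTE na).
have HR3 : R j.+1 (mu3 (treg l.+2)) o2 by rewrite /mu3 /upd treg_vreg.
have [|t4 [mu4 [o4 [He4 Ht4 Hag4 HR4]]]] := IH j.+1 mu3 o2 _ Hag3 HR3.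
  by lia.
eexists; exists mu4, o4; split; [|idtac|exact: Hag4|exact: HR4].
  apply: exec_while_step; last exact: He4.
    by rewrite /= v1 t1; lia.
  apply: exec_seq; first exact: He.
  by apply: exec_assign; rewrite /= v2 addn1.
have bj := bits_le j; have bj1 := bits_le j.+1.
have b1 := bits_le 1.
move: bj1 b1; rewrite /= v1 t1 v2 /treg /vreg ?addn1 => bj1 b1.
rewrite (mulSn r.+1); apply: leq_add Ht4.
rewrite /treg /vreg in bv bt *.
by lia.
Qed.

(** The loop variable is restored at the end, so that seen from outside only temporaries from [l.+1]
    on change. The same invariant [R] serves sums, through the accumulator, and output loops,
    through the output. *)
Lemma exec_for_loop x i l body mu o N T (R : nat -> nat -> seq nat -> Prop) :
  mu (treg l) = N -> R 0 (mu (treg l.+2)) o ->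
  (forall j mu1 o1, j < N ->
     agree l.+1 (upd mu (vreg i) j) mu1 ->
     R j (mu1 (treg l.+2)) o1 ->
     exists t mu2 o2, [/\ exec x body mu1 o1 t mu2 o2, t <= T,
       agree l.+2 mu1 mu2 & R j.+1 (mu2 (treg l.+2)) o2]) ->
  exists t mu2 o2, [/\ exec x (for_loop i l body) mu o t mu2 o2,
    t <= N.+2 * (T + 60 * (N + l + i + mu (vreg i)).+1),
    agree l.+1 mu mu2 & R N (mu2 (treg l.+2)) o2].
Proof.
move=> HN HR Hbody.
pose mu1 := upd mu (treg l.+1) (mu (vreg i)).
pose mu2 := upd mu1 (vreg i) 0.
have H1 : mu1 (treg l) = N by rewrite /mu1 /upd eq_treg; case: eqP => //; lia.
have HR2 : R 0 (mu2 (treg l.+2)) o.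
  by rewrite /mu2 /mu1 /upd treg_vreg eq_treg; case: eqP => //; lia.
have Hbody' j mu3 o3 : j < N -> agree l.+2 (upd mu1 (vreg i) j) mu3 ->
     R j (mu3 (treg l.+2)) o3 ->
     exists t mu2 o2, [/\ exec x body mu3 o3 t mu2 o2, t <= T,
       agree l.+2 mu3 mu2 & R j.+1 (mu2 (treg l.+2)) o2].
  move=> jN Hag; apply: Hbody => //; apply: agree_trans (agreeW _ Hag) => //.
  move=> a Ha; rewrite /upd; case: eqP => // _; rewrite /mu1 /upd.
  by case: eqP => // ea; move: Ha; rewrite ea odd_treg ltnn.
have [||t3 [mu3 [o3 [He3 Ht3 Hag3 HR3]]]] :=
    exec_while_loop H1 Hbody' (r := N) (j := 0) (mu1 := mu2) (o1 := o) _ _ HR2.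
- by [].
- by move=> a _.
have s3 : mu3 (treg l.+1) = mu (vreg i).
  by rewrite (agree_treg _ Hag3) // /upd treg_vreg /mu1 /upd eqxx.
eexists; exists (upd mu3 (vreg i) (mu3 (treg l.+1))), o3; split.
- apply: exec_seq; first exact: exec_store.
  apply: exec_seq; first exact: exec_store.
  by apply: exec_seq; [exact: He3|exact: exec_store].
- rewrite /= -/mu1 s3.
  have bt := bits_le (treg l.+1); have bv := bits_le (vreg i).
  have bN := bits_le N; have bm := bits_le (mu (vreg i)); have b0 := bits_le 0.
  rewrite /treg /vreg in bt bv bm *; set S := mu i.*2 in bm *.
  (* One share beyond those of the loop itself is split off; it pays for saving, resetting and
     restoring the loop variable. *)
  have -> : N.+2 * (T + 60 * (N + l + i + S).+1)
    = N.+1 * (T + 60 * (N + l + i + S).+1) + (T + 60 * (N + l + i + S).+1).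
    by lia.
  have : t3 <= N.+1 * (T + 60 * (N + l + i + S).+1).
    by apply: leq_trans Ht3 _; rewrite leq_mul2l; apply/orP; right; lia.
  by lia.
- move=> a Ha; rewrite /upd; case: eqP => [->|/eqP na]; first exact: s3.
  rewrite Hag3; last by move: Ha; rewrite /treg; lia.
  rewrite /upd (negbTE na) /mu1 /upd; case: eqP => // ea; move: Ha.
  by rewrite ea odd_treg ltnn.
- by rewrite /upd treg_vreg.
Qed.

(** * Polynomial bounds *)

Lemma pow_const B c : 2 <= B -> c <= B ^ c.
Proof.
case: c => // c HB; apply: leq_trans (ltnW (ltn_expl _ (isT : 1 < 2))) _.
by rewrite leq_exp2r.
Qed.

(** All bounds are kept as powers of one base. For positive [P] and [Q] we have
    [P + Q <= 2 * (P * Q)], so one more factor [B >= 2] turns a sum into a product. *)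
Lemma pow_add B a b p q :
  2 <= B -> a <= B ^ p -> b <= B ^ q -> a + b <= B ^ (p + q).+1.
Proof.
move=> HB Ha Hb; rewrite expnS expnD.
have : 0 < B ^ p by rewrite expn_gt0; lia.
have : 0 < B ^ q by rewrite expn_gt0; lia.
move: (B ^ p) (B ^ q) Ha Hb => P Q Ha Hb HQ HP.
apply: leq_trans (_ : 2 * (P * Q) <= _); first by nia.
exact: leq_mul.
Qed.

Lemma pow_mul B a b p q : a <= B ^ p -> b <= B ^ q -> a * b <= B ^ (p + q).
Proof. by move=> Ha Hb; rewrite expnD leq_mul. Qed.

Lemma pow_id B a : a <= B -> a <= B ^ 1.
Proof. by []. Qed.

Lemma pow_widen B p q : 2 <= B -> p <= q -> B ^ p <= B ^ q.
Proof. by move=> HB; apply: leq_pexp2l; lia. Qed.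

Lemma pow_bits B a p : 2 <= B -> a <= B ^ p -> bits a <= B ^ (p + 1).+1.
Proof.
move=> HB Ha; apply: leq_trans (bits_le a) _; rewrite -addn1.
exact: pow_add (pow_const 1 HB).
Qed.

Definition bounded (B : nat) (x : seq nat) (env : nat -> nat) : Prop :=
  [/\ 2 <= B, forall a, nth 0 x a <= B & forall i, env i <= B].

Lemma bounded_upd B B' x env i j :
  bounded B x env -> B <= B' -> j <= B' -> bounded B' x (upd env i j).
Proof.
move=> [H2 Hx He] HB Hj; split=> [|a|a]; first exact: leq_trans HB.
  exact: leq_trans (Hx a) HB.
by rewrite /upd; case: eqP => // _; exact: leq_trans (He a) HB.
Qed.

(** The exponent depends on the term alone, which makes the bound polynomial. In a sum the index is
    below [B ^ d1], so the summand is bounded over the base [B ^ d1.+1], and the exponents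
    multiply. *)
Lemma den_pow e : exists d, forall B x env,
  bounded B x env -> den x env e <= B ^ d.
Proof.
elim: e => [c|i|e [d IH]|o e1 [d1 IH1] e2 [d2 IH2]|i e1 [d1 IH1] e2 [d2 IH2]].
- by exists c => B x env [HB _ _]; exact: pow_const.
- by exists 1 => B x env [_ _ He] /=; rewrite expn1.
- by exists 1 => B x env [_ Hx _] /=; rewrite expn1.
- exists (d1 + d2).+1 => B x env Hb; have [HB _ _] := Hb.
  have H1 := IH1 _ _ _ Hb; have H2 := IH2 _ _ _ Hb.
  have W1 : B ^ d1 <= B ^ (d1 + d2).+1 by apply: pow_widen => //; lia.
  case: o => /=.
  + exact: pow_add.
  + by apply: leq_trans (leq_subr _ _) _; exact: leq_trans W1.
  + apply: leq_trans (pow_mul H1 H2) _; exact: pow_widen.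
  + by apply: leq_trans (leq_div _ _) _; exact: leq_trans W1.
- exists (d1 + d1.+1 * d2) => B x env Hb /=; have [HB _ _] := Hb.
  have H1 := IH1 _ _ _ Hb.
  set N := den x env e1 in H1 *.
  apply: leq_trans (_ : \sum_(j < N) B ^ (d1.+1 * d2) <= _).
    apply: leq_sum => j _; rewrite expnM; apply: IH2.
    apply: bounded_upd Hb _ _.
      by rewrite -{1}(expn1 B) pow_widen.
    apply: leq_trans (ltnW (ltn_ord j)) _; apply: leq_trans H1 _.
    exact: pow_widen.
  by rewrite sum_nat_const card_ord; exact: pow_mul.
Qed.

Lemma pow_succ B a p : 2 <= B -> a <= B ^ p -> a.+1 <= B ^ (p + 1).+1.
Proof. by move=> HB Ha; rewrite -addn1; exact: pow_add (pow_const 1 HB). Qed.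

(** The exponent in the goal may be an existential variable, instantiated by descending into the
    left-hand side. Being created before [B] and the input are introduced, it cannot depend on
    them. *)
Ltac poly_bound HB :=
  lazymatch goal with
  | |- is_true (_ + _ <= _) => apply: (pow_add HB); poly_bound HB
  | |- is_true (_ * _ <= _) => apply: pow_mul; poly_bound HB
  | |- is_true (bits _ <= _) => apply: (pow_bits HB); poly_bound HB
  | |- _ => first [eassumption | exact: leqnn | exact: pow_const HB
                  | apply: (pow_succ HB); poly_bound HB]
  end.

(** * Correctness and running time of the compiled programs *)

Lemma vars_agree l mu mu' : agree l mu mu' -> vars mu' =1 vars mu.
Proof. by move=> H i; exact: agree_vreg H. Qed.

Lemma bounded_eq B x env env' :
  env' =1 env -> bounded B x env -> bounded B x env'.
Proof. by move=> E [H1 H2 H3]; split=> // i; rewrite E. Qed.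

Lemma bounded_pow B x env i j p N : bounded B x env -> N <= B ^ p -> j < N ->
  bounded (B ^ p.+1) x (upd env i j).
Proof.
move=> Hb HN Hj; have [HB _ _] := Hb; apply: bounded_upd Hb _ _.
  by rewrite -{1}(expn1 B) pow_widen.
apply: leq_trans (ltnW Hj) _; apply: leq_trans HN _; exact: pow_widen.
Qed.

Lemma vars_upd mu i j : vars (upd mu (vreg i) j) =1 upd (vars mu) i j.
Proof. by move=> a; rewrite /vars /upd eq_vreg. Qed.

Lemma comp_correct e l : exists d, forall B x mu o,
  bounded B x (vars mu) ->
  exists t mu', [/\ exec x (comp e l) mu o t mu' o, t <= B ^ d,
    agree l mu mu' & mu' (treg l) = den x (vars mu) e].
Proof.
elim: e l => [c|i|e IH|o1 e1 IH1 e2 IH2|i e1 IH1 e2 IH2] l.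
- eexists=> B x mu o [HB _ _].
  eexists; eexists; split; [exact: exec_assign| |exact: agree_upd (odd_treg l) _|].
    by rewrite /=; poly_bound HB.
  by rewrite /upd eqxx.
- eexists=> B x mu o [HB _ He].
  have Hi := pow_id (He i); rewrite /vars in Hi.
  eexists; eexists; split; [exact: exec_assign| |exact: agree_upd (odd_treg l) _|].
    by rewrite /=; poly_bound HB.
  by rewrite /upd eqxx.
- have [d IH1] := IH l; have [d1 Hd] := den_pow e.
  eexists=> B x mu o Hb; have [HB Hx He] := Hb.
  have [t1 [mu1 [E1 T1 A1 R1]]] := IH1 B x mu o Hb.
  have D1 := Hd _ _ _ Hb; have X1 := pow_id (Hx (den x (vars mu) e)).
  eexists; eexists; split.
  + by apply: exec_seq E1 _; exact: exec_assign.
  + by rewrite /= R1; poly_bound HB.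
  + by apply: agree_trans A1 _; exact: agree_upd (odd_treg l) _.
  + by rewrite /upd eqxx /= R1.
- have [d1 {}IH1] := IH1 l; have [p1 D1] := den_pow e1.
  have [d2 {}IH2] := IH2 l.+1; have [p2 D2] := den_pow e2.
  have [p Dp] := den_pow (TOp o1 e1 e2).
  eexists=> B x mu o Hb; have [HB Hx He] := Hb.
  have [t1 [mu1 [E1 T1 A1 R1]]] := IH1 B x mu o Hb.
  have V1 := vars_agree A1.
  have [t2 [mu2 [E2 T2 A2 R2]]] := IH2 B x mu1 o (bounded_eq V1 Hb).
  have := D1 _ _ _ Hb; have := D2 _ _ _ Hb; have := Dp _ _ _ Hb => /= F F2 F1.
  have R1' : mu2 (treg l) = den x (vars mu) e1.
    by rewrite (agree_treg _ A2).
  rewrite (eq_den _ _ V1) in R2.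
  eexists; eexists; split.
  + by apply: exec_seq E1 _; apply: exec_seq E2 _; exact: exec_assign.
  + by rewrite /= R1' R2; poly_bound HB.
  + apply: agree_trans A1 _; apply: agree_trans (agreeW _ A2) _ => //.
    exact: agree_upd (odd_treg l) _.
  + by rewrite /upd eqxx /= R1' R2.
- have [d1 {}IH1] := IH1 l; have [p1 D1] := den_pow e1.
  have [d2 {}IH2] := IH2 l.+3; have [p2 D2] := den_pow e2.
  have [p Dp] := den_pow (TSum i e1 e2).
  (* Exponents for one pass through the body and for the whole loop, left open until [poly_bound]
     determines them. *)
  evar (dT : nat); evar (dL : nat).
  eexists=> B x mu o Hb; have [HB Hx He] := Hb.
  have [t1 [mu1 [E1 T1 A1 R1]]] := IH1 B x mu o Hb.
  have V1 := vars_agree A1.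
  set N := den x (vars mu) e1 in R1.
  have N1 : N <= B ^ p1 := D1 _ _ _ Hb.
  have F := Dp _ _ _ Hb.
  pose S j := \sum_(r < j) den x (upd (vars mu) i r) e2.
  have SN : S N = den x (vars mu) (TSum i e1 e2) by [].
  pose mu2 := upd mu1 (treg l.+2) 0.
  have A2 : agree l mu mu2.
    by apply: agree_trans A1 _; apply: agree_upd (odd_treg _) _; rewrite /treg; lia.
  have M2 : mu2 (treg l) = N.
    by rewrite /mu2 /upd eq_treg R1; case: eqP => //; lia.
  have [||t3 [mu3 [o3 [E3 T3 A3 [S3 O3]]]]] :=
    @exec_for_loop x i l (Seq (comp e2 l.+3)
               (assign (treg l.+2)
                  (Op Add (rd (treg l.+2)) (rd (treg l.+3)))))
     mu2 o N (B ^ dT) (fun j a o' => a = S j /\ o' = o) M2.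
  + by rewrite /mu2 /upd eqxx /S big_ord0.
  + move=> j mu4 o4 jN A4 [S4 ->].
    have V4 : vars mu4 =1 upd (vars mu) i j.
      move=> a; rewrite (vars_agree A4) vars_upd /upd; case: eqP => // _.
      exact: (vars_agree A2).
    have Hb4 := bounded_pow i Hb N1 jN.
    have [t5 [mu5 [E5 T5 A5 R5]]] := IH2 _ x mu4 o (bounded_eq V4 Hb4).
    have D5 := D2 _ _ _ Hb4.
    rewrite (eq_den _ _ V4) in R5.
    have S5 : mu5 (treg l.+2) = S j by rewrite (agree_treg _ A5).
    have Sj : S j.+1 = S j + den x (upd (vars mu) i j) e2.
      by rewrite /S big_ord_recr.
    eexists; eexists; eexists; split; [|idtac| |split; last by []].
    * by apply: exec_seq E5 _; exact: exec_assign.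
    (* A partial sum is at most the full sum, whose bound is already known. *)
    * have S1 : S j.+1 <= B ^ p.
        apply: leq_trans F; rewrite -SN /S -(subnKC jN) big_split_ord /=.
        exact: leq_addr.
      have S0 : S j <= B ^ p by apply: leq_trans S1; rewrite Sj leq_addr.
      rewrite -expnM in T5; rewrite -expnM in D5.
      by rewrite /= S5 R5 -Sj /dT; poly_bound HB.
    * apply: agree_trans (agreeW (leqnSn _) A5) _.
      by apply: agree_upd (odd_treg _) _.
    * by rewrite /upd eqxx /= S5 R5 Sj.
  have Hi : mu2 (vreg i) <= B ^ 1.
    by rewrite (agree_vreg i A2) expn1; exact: He.
  eexists; eexists; split.
  + apply: exec_seq E1 _; apply: exec_seq; first exact: exec_assign.
    apply: exec_seq; last exact: exec_assign.
    by rewrite O3 in E3; exact: E3.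
  + rewrite /= S3 SN.
    have {}T3 : t3 <= B ^ dL.
      by apply: leq_trans T3 _; rewrite /dL; poly_bound HB.
    by poly_bound HB.
  + apply: agree_trans A2 _; apply: agree_trans (agreeW _ A3) _ => //.
    exact: agree_upd (odd_treg l) _.
  + by rewrite /upd eqxx /= S3.
Qed.

Lemma ocomp_correct p l : exists d, forall B x mu o,
  bounded B x (vars mu) ->
  exists t mu', [/\ exec x (ocomp p l) mu o t mu' (o ++ oden x (vars mu) p),
    t <= B ^ d & agree l mu mu'].
Proof.
elim: p l => [e|p1 IH1 p2 IH2|i e p IH] l.
- have [d1 C1] := comp_correct e l; have [p1 D1] := den_pow e.
  eexists=> B x mu o Hb; have [HB Hx He] := Hb.
  have [t1 [mu1 [E1 T1 A1 R1]]] := C1 B x mu o Hb.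
  have F1 := D1 _ _ _ Hb.
  eexists; exists mu1; split; [|idtac|by []].
  + by rewrite /= -R1 cats1; apply: exec_seq E1 _; exact: exec_write.
  + by rewrite /= R1; poly_bound HB.
- have [d1 {}IH1] := IH1 l; have [d2 {}IH2] := IH2 l.
  eexists=> B x mu o Hb; have [HB Hx He] := Hb.
  have [t1 [mu1 [E1 T1 A1]]] := IH1 B x mu o Hb.
  have V1 := vars_agree A1.
  have [t2 [mu2 [E2 T2 A2]]] := IH2 B x mu1 (o ++ oden x (vars mu) p1)
    (bounded_eq V1 Hb).
  rewrite (eq_oden _ _ V1) -catA in E2.
  eexists; exists mu2; split; first by apply: exec_seq E1 E2.
  + by poly_bound HB.
  + exact: agree_trans A1 A2.
- have [d1 C1] := comp_correct e l; have [p1 D1] := den_pow e.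
  have [d2 {}IH] := IH l.+2.
  evar (dL : nat).
  eexists=> B x mu o Hb; have [HB Hx He] := Hb.
  have [t1 [mu1 [E1 T1 A1 R1]]] := C1 B x mu o Hb.
  have V1 := vars_agree A1.
  have N1 := D1 _ _ _ Hb.
  set N := den x (vars mu) e in R1 N1.
  pose S j := flatten [seq oden x (upd (vars mu) i r) p | r <- iota 0 j].
  have [||t3 [mu3 [o3 [E3 T3 A3 O3]]]] :=
    @exec_for_loop x i l (ocomp p l.+2) mu1 o N (B ^ (p1.+1 * d2))
      (fun j _ o' => o' = o ++ S j) R1.
  + by rewrite cats0.
  + move=> j mu4 o4 jN A4 ->.
    have V4 : vars mu4 =1 upd (vars mu) i j.
      by move=> a; rewrite (vars_agree A4) vars_upd /upd; case: eqP => // _.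
    have Hb4 := bounded_pow i Hb N1 jN.
    have [t5 [mu5 [E5 T5 A5]]] := IH _ x mu4 (o ++ S j) (bounded_eq V4 Hb4).
    rewrite (eq_oden _ _ V4) -catA in E5.
    eexists; exists mu5; eexists; split; [exact: E5| |exact: A5|].
    * by rewrite expnM.
    * by rewrite /S -addn1 iotaD map_cat flatten_cat /= cats0.
  have Hi : mu1 (vreg i) <= B ^ 1.
    by rewrite (agree_vreg i A1) expn1; exact: He.
  eexists; exists mu3; split.
  + by rewrite O3 in E3; apply: exec_seq E1 E3.
  + have {}T3 : t3 <= B ^ dL.
      by apply: leq_trans T3 _; rewrite /dL; poly_bound HB.
    by poly_bound HB.
  + by apply: agree_trans A1 (agreeW _ A3).
Qed.

Lemma ocomp_outputs p : exists d, forall B x, 2 <= B ->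
  (forall a, nth 0 x a <= B) ->
  exists t mu, t <= B ^ d /\
    exec x (ocomp p 0) (fun=> 0) [::] t mu (oden x (fun=> 0) p).
Proof.
have [d Hd] := ocomp_correct p 0; exists d => B x HB Hx.
have [|t [mu [E T _]]] := Hd B x (fun=> 0) [::]; first by [].
by exists t, mu.
Qed.

(** * The reduction *)

Section Rank.
Variable P : nat -> bool.

Lemma rank_lt v v' : P v -> v < v' -> \sum_(u < v) P u < \sum_(u < v') P u.
Proof.
move=> Pv lt; rewrite -(subnKC lt) big_split_ord /= big_ord_recr /= Pv addn1.
exact: leq_addr.
Qed.

Lemma rank_inj v v' :
  P v -> P v' -> \sum_(u < v) P u = \sum_(u < v') P u -> v = v'.
Proof.
move=> Pv Pv' E; case: (ltngtP v v') => // lt.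
  by have := rank_lt Pv lt; rewrite E ltnn.
by have := rank_lt Pv' lt; rewrite E ltnn.
Qed.

(** No other number satisfying [P] has the rank of [v0], so a single summand survives. This
    expresses selection by rank as a bounded sum. *)
Lemma sum_rank_eq M v0 : v0 < M -> P v0 ->
  \sum_(v < M) v * (P v * (\sum_(u < v) P u == \sum_(u < v0) P u)) = v0.
Proof.
move=> lt P0; rewrite (bigD1 (Ordinal lt)) //= P0 eqxx !muln1 big1 ?addn0 // => v.
rewrite -val_eqE /= => ne; case Pv: (P v); last by rewrite muln0.
case: eqP => [E|_]; last by rewrite muln0.
by case/eqP: ne; apply: rank_inj.
Qed.

Lemma rank_ex M i : i < \sum_(u < M) P u ->
  exists v, [/\ v < M, P v & \sum_(u < v) P u = i].
Proof.
elim: M => [|M IH]; first by rewrite big_ord0.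
rewrite big_ord_recr /=; case: (ltnP i (\sum_(u < M) P u)) => [lt _|ge].
  by have [v [? ? ?]] := IH lt; exists v; split=> //; apply: ltnW.
case PM: (P M) => /=; last by rewrite addn0 ltnNge ge.
by rewrite addn1 ltnS => le; exists M; split=> //; apply/anti_leq/andP.
Qed.

End Rank.

(** Comparisons with values 0 and 1, obtained from truncated subtraction since the machine has no
    comparison operation. *)
Definition eqN (a b : nat) : nat := 1 - ((a - b) + (b - a)).
Definition ltN (a b : nat) : nat := 1 - (a.+1 - b).

Lemma eqNE a b : eqN a b = (a == b).
Proof. by rewrite /eqN; lia. Qed.

Lemma ltNE a b : ltN a b = (a < b).
Proof. by rewrite /ltN; lia. Qed.

Lemma map_iota_ord (T : Type) (F : nat -> T) k :
  map F (iota 0 k) = [seq F i | i : 'I_k <- enum 'I_k].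
Proof. by rewrite -val_enum_ord -map_comp. Qed.

Lemma flatten_map_filter (S T : Type) (P : pred S) (F : S -> seq T) s :
  flatten [seq F p | p <- s & P p] = flatten [seq if P p then F p else [::] | p <- s].
Proof. by elim: s => //= p s <-; case: (P p). Qed.

Lemma flatten_map_allpairs (S T U V : Type) (f : S -> T -> U) (F : U -> seq V) s t :
  flatten [seq F p | p <- [seq f a b | a <- s, b <- t]] =
  flatten [seq flatten [seq F (f a b) | b <- t] | a <- s].
Proof.
by elim: s => //= a s <-; rewrite map_cat flatten_cat -map_comp.
Qed.

Lemma nth_allpairs (S T U : Type) (f : S -> T -> U) x y z s t i j :
  i < size s -> j < size t ->
  nth z [seq f a b | a <- s, b <- t] (i * size t + j) = f (nth x s i) (nth y t j).
Proof.
move=> + lj; elim: s i => [//|a s IH] [|i] /= lt.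
  by rewrite nth_cat size_map lj (nth_map y).
rewrite nth_cat size_map mulSn -addnA ltnNge leq_addr /= addKn; exact: IH.
Qed.

(** * Edges of the pattern as increasing pairs, and their incidences *)

Section Edges.
Variables (k : nat) (H : sgraph 'I_k).

(** Every edge occurs once, oriented upwards. The lexicographic order is the one in which nested
    loops over both ends meet the edges. *)
Definition arcs : seq ('I_k * 'I_k) :=
  [seq p : 'I_k * 'I_k <- [seq (a, b) | a <- enum 'I_k, b <- enum 'I_k]
     | (p.1 < p.2) && adj H p.1 p.2].

Lemma mem_arcs (p : 'I_k * 'I_k) : (p \in arcs) = (p.1 < p.2) && adj H p.1 p.2.
Proof.
rewrite mem_filter andb_idr // => _; case: p => a b.
by apply/allpairsP; exists (a, b); rewrite !mem_enum.
Qed.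

Lemma arcs_uniq : uniq arcs.
Proof.
apply/filter_uniq/allpairs_uniq; try exact: enum_uniq.
by move=> [a b] [c d] _ _ [-> ->].
Qed.

Lemma arc_set_inj :
  {in arcs &, injective (fun p : 'I_k * 'I_k => [set p.1; p.2])}.
Proof.
move=> [a b] [c d]; rewrite !mem_arcs /= => /andP[ab _] /andP[cd _] E.
have : a \in [set c; d] by rewrite -E !inE eqxx.
have : b \in [set c; d] by rewrite -E !inE eqxx orbT.
rewrite !inE => /orP[]/eqP bE /orP[]/eqP aE; subst a b => //.
- by rewrite ltnn in ab.
- by rewrite ltnNge ltnW in ab.
- by rewrite ltnn in ab.
Qed.

Lemma size_arcs : #|edges H| = size arcs.
Proof.
rewrite -(size_map (fun p : 'I_k * 'I_k => [set p.1; p.2])).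
have /card_uniqP <- : uniq [seq [set p.1; p.2] | p <- arcs].
  by rewrite map_inj_in_uniq ?arcs_uniq //; exact: arc_set_inj.
apply: eq_card => e; apply/imsetP/mapP => [[[a b]]|[[a b]]].
  rewrite inE /= => ab ->; case: (ltngtP a b) => [lt|gt|E].
  - by exists (a, b); rewrite ?mem_arcs /= ?lt.
  - by rewrite adj_sym in ab; exists (b, a); rewrite ?mem_arcs /= ?gt // setUC.
  - by move: ab; rewrite (val_inj E) adj_irr.
by rewrite mem_arcs => /andP[_ ab] ->; exists (a, b); rewrite ?inE.
Qed.

Definition arc (j : 'I_#|edges H|) : 'I_k * 'I_k :=
  tnth (in_tuple arcs) (cast_ord size_arcs j).

Lemma arc_mem j : (arc j).1 < (arc j).2 /\ adj H (arc j).1 (arc j).2.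
Proof. by apply/andP; rewrite -mem_arcs mem_tnth. Qed.

Lemma arc_neq j : (arc j).1 != (arc j).2.
Proof. by have [lt _] := arc_mem j; rewrite neq_ltn lt. Qed.

Lemma arc_inj : injective arc.
Proof.
by move=> i j /tuple_uniqP E; apply: (@cast_ord_inj _ _ size_arcs); apply: E;
  exact: arcs_uniq.
Qed.

Lemma arc_surj (a b : 'I_k) : a < b -> adj H a b -> exists j, arc j = (a, b).
Proof.
move=> lt ab; have : (a, b) \in in_tuple arcs by rewrite mem_arcs /= lt.
case/tnthP => i ->; exists (cast_ord (esym size_arcs) i).
by rewrite /arc cast_ordKV.
Qed.

Lemma map_arc T (F : 'I_k * 'I_k -> T) :
  [seq F (arc j) | j <- enum 'I_#|edges H|] = map F arcs.
Proof.
(* Generalizing the number of edges allows substituting it, after which the cast is the identity. *)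
rewrite /arc; move: size_arcs; move: #|edges H| => m E; subst m.
rewrite -(congr1 (map F) (map_tnth_enum (in_tuple arcs))) -map_comp.
by apply: eq_map => j; rewrite cast_ord_id.
Qed.

Definition incident (h : 'I_k) (j : 'I_#|edges H|) : bool :=
  ((arc j).1 == h) || ((arc j).2 == h).

Lemma card_ends j : #|[set h | incident h j]| = 2.
Proof.
have -> : [set h | incident h j] = [set (arc j).1; (arc j).2].
  by apply/setP => h; rewrite !inE /incident !(eq_sym h).
by rewrite cards2 arc_neq.
Qed.

Hypothesis cub : cubic H.

(** Sending an incident edge to its other end is a bijection onto the neighbours of [h]. It is
    injective because an edge is determined by its ends, all edges being oriented upwards. *)
Lemma card_incident h : #|[set j | incident h j]| = 3.
Proof.
pose far j := if (arc j).1 == h then (arc j).2 else (arc j).1.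
rewrite -(cub h) -(card_in_imset (f := far)).
  apply: eq_card => b; rewrite inE; apply/imsetP/idP => [[j]|hb].
    have [_ ab] := arc_mem j.
    rewrite inE /incident /far; case: eqP => [<- _ -> //|_ /= /eqP <- ->].
    by rewrite adj_sym.
  case: (ltngtP h b) => [lt|gt|E].
  - have [j jE] := arc_surj lt hb.
    by exists j; rewrite ?inE /incident /far jE /= eqxx.
  - rewrite adj_sym in hb; have [j jE] := arc_surj gt hb.
    exists j; rewrite ?inE /incident /far jE /= ?eqxx ?orbT //.
    by case: eqP => // E; rewrite E ltnn in gt.
  - by move: hb; rewrite (val_inj E) adj_irr.
move=> i j; rewrite !inE /incident /far => hi hj E; apply: arc_inj.
have [lti _] := arc_mem i; have [ltj _] := arc_mem j.
move: hi hj E lti ltj; case: (arc i) (arc j) => [a b] [c d] /=.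
case: (a =P h) => [->|_]; case: (c =P h) => [->|_] //=.
- by move=> _ _ ->.
- by move=> _ /eqP -> ->; lia.
- by move=> /eqP -> _ ->; lia.
- by move=> /eqP -> /eqP -> ->.
Qed.

(** Double counting of incidences: two per edge, three per vertex. *)
Lemma handshake : 2 * #|edges H| = 3 * k.
Proof.
have <- : \sum_(j < #|edges H|) \sum_(h < k) incident h j = 2 * #|edges H|.
  rewrite (eq_bigr (fun=> 2)) ?sum_nat_const ?card_ord 1?mulnC // => j _.
  by rewrite -(card_ends j) -sum1dep_card [RHS]big_mkcond; apply: eq_bigr => h _;
    case: incident.
rewrite exchange_big (eq_bigr (fun=> 3)) /= ?sum_nat_const ?card_ord 1?mulnC //.
move=> h _; rewrite -(card_incident h) -sum1dep_card [RHS]big_mkcond.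
by apply: eq_bigr => j _; case: incident.
Qed.

End Edges.

(** * Choices of vertices and the numbers computed from them *)

Section Reduction.
Variables (k n : nat) (aH aG : nat -> nat -> nat) (col : nat -> nat).

(* The [i]-th vertex of colour [h]. *)
Definition fib (h i : nat) : nat :=
  \sum_(v < k * n) v * (eqN (col v) h * eqN (\sum_(u < v) eqN (col u) h) i).

(* The position of [b] among the neighbours of [h]. *)
Definition slot (h b : nat) : nat := \sum_(c < b) aH h c.

(** This is [n ^ j] for [j < 3] and zero beyond. *)
Definition weight (j : nat) : nat := eqN j 0 + (eqN j 1 * n + eqN j 2 * (n * n)).

(* A choice is written in base [n]: the leading digit selects the vertex in the
   class of [h], the digit at position [slot h b] the one in the class of [b].
   Remainders are spelled out for want of a machine operation. *)
Definition dig (s j : nat) : nat := s %/ weight j - s %/ weight j %/ n * n.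

Definition top (s : nat) : nat := s %/ (n * n * n).

Definition invalid (h s : nat) : nat :=
  \sum_(b < k) aH h b * (1 - aG (fib h (top s)) (fib b (dig s (slot h b)))).

Definition valid (h s : nat) : nat := 1 - invalid h s.

Definition nsel : nat := n * n * n * n.

(* The sum has at most one nonzero term; it is 0 if no choice is admissible. *)
Definition first_valid (h : nat) : nat :=
  \sum_(s < nsel) s * (valid h s * eqN (\sum_(r < s) valid h r) 0).

(* Nonzero iff some list has no admissible choice. *)
Definition stuck : nat := \sum_(h < k) eqN (\sum_(s < nsel) valid h s) 0.

Definition pick (h s : nat) : nat :=
  valid h s * s + (1 - valid h s) * first_valid h.

(** Both number the pair chosen for an edge from 1 to [n ^ 2], with the vertex of the lower end
    leading. In [lcode] the list owner [h] is the lower end, in [ucode] the upper one, whence the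
    exchanged digits. *)
Definition lcode (h b s : nat) : nat := top s * n + dig s (slot h b) + 1.
Definition ucode (h b s : nat) : nat := dig s (slot h b) * n + top s + 1.

(** The sign flag of [encode_int] for an edge with upper end [b]: set when [h] is that end, and
    never set once some list is stuck. *)
Definition sgn (h b : nat) : nat := eqN h b * (1 - stuck).
Definition mag (h s a b : nat) : nat :=
  eqN h a * lcode h b (pick h s) + eqN h b * ucode h a (pick h s).

Definition validb (h s : nat) : bool := invalid h s == 0.

Lemma validE h s : valid h s = validb h s.
Proof. by rewrite /valid /validb; case: (invalid h s). Qed.

(** The first admissible choice is the one of rank zero, and [sum_rank_eq] evaluates the sum to
    it. *)
Lemma first_validP h s : s < nsel -> validb h s ->
  validb h (first_valid h) /\ first_valid h < nsel.
Proof.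
move=> lt vs.
have [|v [vM Pv rv]] := @rank_ex (validb h) nsel 0.
  by apply: leq_ltn_trans (rank_lt vs lt).
suff -> : first_valid h = v by [].
rewrite -[RHS](sum_rank_eq vM Pv); apply: eq_bigr => r _.
rewrite validE eqNE rv; congr (_ * (_ * (_ == _))).
by apply: eq_bigr => i _; rewrite validE.
Qed.

Lemma first_valid_lt h : 0 < nsel -> first_valid h < nsel.
Proof.
move=> n0; have [|no] := boolP [exists s : 'I_nsel, validb h s].
  by case/existsP => s /(first_validP (ltn_ord s)) [].
rewrite /first_valid big1 // => s _; rewrite validE.
by move/existsPn/(_ s)/negbTE: no => ->; rewrite muln0.
Qed.

Lemma pick_lt h s : s < nsel -> pick h s < nsel.
Proof.
move=> lt; rewrite /pick validE; case: validb => /=.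
  by rewrite mul1n subnn addn0.
by rewrite mul0n add0n subn0 mul1n first_valid_lt //; lia.
Qed.

Lemma pick_id h s : validb h s -> pick h s = s.
Proof. by move=> v; rewrite /pick validE v /= subnn mul1n addn0. Qed.

Lemma stuckP : reflect (exists h : 'I_k, forall s : 'I_nsel, ~~ validb h s)
  (stuck != 0).
Proof.
rewrite /stuck sum_nat_eq0 negb_forall; apply: (iffP existsP).
  case=> h; rewrite eqNE /= eqb0 negbK sum_nat_eq0 => /forallP H.
  by exists h => s; have := H s; rewrite /= validE eqb0.
case=> h H; exists h; rewrite eqNE /= eqb0 negbK sum_nat_eq0.
by apply/forallP => s; rewrite /= validE eqb0 H.
Qed.

Lemma pick_valid (h : 'I_k) s : stuck = 0 -> s < nsel -> validb h (pick h s).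
Proof.
move=> st lt; have [vs|vs] := boolP (validb h s); first by rewrite pick_id.
rewrite /pick validE (negbTE vs) mul0n add0n subn0 mul1n.
have [/existsP[r vr]|no] := boolP [exists r : 'I_nsel, validb h r].
  by have [] := first_validP (ltn_ord r) vr.
suff : stuck != 0 by rewrite st.
by apply/stuckP; exists h; apply/existsPn.
Qed.

Lemma digE s j : dig s j = (s %/ weight j) %% n.
Proof. by rewrite /dig {1}(divn_eq (s %/ weight j) n) addKn. Qed.

Lemma top_lt s : s < nsel -> top s < n.
Proof.
move=> lt; have n0 : 0 < n * n * n by rewrite /nsel in lt; nia.
by rewrite /top ltn_divLR // mulnC.
Qed.

Lemma dig_lt s j : 0 < n -> dig s j < n.
Proof. by move=> n0; rewrite digE ltn_pmod. Qed.

Lemma selection_ex i (w : nat -> nat) : i < n -> (forall j, j < 3 -> w j < n) ->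
  exists s, [/\ s < nsel, top s = i & forall j, j < 3 -> dig s j = w j].
Proof.
move=> lt Hw; have n0 : 0 < n by lia.
have w0 := Hw 0 isT; have w1 := Hw 1 isT; have w2 := Hw 2 isT.
(* The base [n] numeral in which digit [j] has weight [n ^ j], with [i] in front. *)
exists (((i * n + w 2) * n + w 1) * n + w 0).
have D0 a b : b < n -> (a * n + b) %/ n = a.
  by move=> lb; rewrite divnMDl // divn_small // addn0.
have M0 a b : b < n -> (a * n + b) %% n = b.
  by move=> lb; rewrite modnMDl modn_small.
split.
- have step a b M : a < M -> b < n -> a * n + b < M * n.
    by move=> lm lb; have := leq_mul lm (leqnn n); rewrite mulSn; lia.
  by rewrite /nsel; apply: (step _ _ _ _ w0); apply: (step _ _ _ _ w1);
    apply: (step _ _ _ _ w2).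
- by rewrite /top !divnMA !D0.
- case=> [|[|[|//]]] _; rewrite digE /weight !eqNE /= ?mul0n ?mul1n ?addn0 ?add0n.
  + by rewrite divn1 M0.
  + by rewrite D0 // M0.
  + by rewrite divnMA !D0 // M0.
Qed.

(** * Correctness when the numerical tables describe an instance *)

Variable I : csi_instance k n.
Hypothesis aHE : forall a b : 'I_k, aH a b = adj (pattern I) a b.
Hypothesis aGE : forall u v : 'I_(k * n), aG u v = adj (host I) u v.
Hypothesis colE : forall v : 'I_(k * n), col v = color I v.
Hypothesis cub : cubic (pattern I).

Lemma fibre_count (h : 'I_k) : \sum_(v < k * n) (col v == h) = n.
Proof.
rewrite -[RHS](color_fibre I h) -sum1dep_card [RHS]big_mkcond /=.
by apply: eq_bigr => v _; rewrite colE val_eqE; case: eqP.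
Qed.

Lemma fib_rank (h : 'I_k) v : v < k * n -> col v == h ->
  fib h (\sum_(u < v) (col u == h)) = v.
Proof.
move=> lt hv; rewrite -[RHS](@sum_rank_eq (fun u => col u == h) _ v lt hv).
apply: eq_bigr => u _; rewrite !eqNE; congr (_ * (_ * (_ == _))).
by apply: eq_bigr => i _; rewrite eqNE.
Qed.

(** A colour class has exactly [n] vertices, so each rank below [n] is attained. With [fib_surj],
    this shows that [fib h] enumerates the class of [h]. *)
Lemma fib_color (h : 'I_k) i : i < n ->
  exists2 v : 'I_(k * n), color I v = h & fib h i = v.
Proof.
rewrite -{1}(fibre_count h) => /(@rank_ex (fun v => col v == h)).
case=> v [lt hv <-]; exists (Ordinal lt); last exact: fib_rank.
by apply/val_inj/eqP; rewrite /= -colE.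
Qed.

Lemma fib_surj (v : 'I_(k * n)) :
  exists2 i, i < n & fib (color I v) i = v.
Proof.
have hv : col v == color I v by rewrite colE.
exists (\sum_(u < v) (col u == color I v)); last by rewrite fib_rank.
rewrite -[X in _ < X](fibre_count (color I v)).
exact: (@rank_lt (fun u => col u == color I v)).
Qed.

(** Presents a slot as a rank, so that the rank lemmas apply. The table [aH] is known to be
    0/1-valued only below [k], hence the bound on [b]. *)
Lemma slotE (h : 'I_k) b : b <= k -> slot h b = \sum_(c < b) (0 < aH h c).
Proof.
move=> le; apply: eq_bigr => c _.
by have := aHE h (widen_ord le c) => /= ->; case: adj.
Qed.

Lemma degree_sum (h : 'I_k) : \sum_(b < k) (0 < aH h b) = 3.
Proof.
rewrite -(cub h) -sum1dep_card [RHS]big_mkcond /=.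
by apply: eq_bigr => b _; rewrite aHE; case: adj.
Qed.

Lemma slot_lt3 (h b : 'I_k) : adj (pattern I) h b -> slot h b < 3.
Proof.
move=> hb; rewrite slotE; last exact: ltnW.
rewrite -(degree_sum h).
by apply: (@rank_lt (fun c => 0 < aH h c)) => //; rewrite aHE hb.
Qed.

Lemma slot_inj (h b b' : 'I_k) : adj (pattern I) h b -> adj (pattern I) h b' ->
  slot h b = slot h b' -> b = b'.
Proof.
move=> hb hb'; rewrite !slotE; try exact: ltnW.
by move/(@rank_inj (fun c => 0 < aH h c)) => E; apply: val_inj; apply: E;
  rewrite aHE ?hb ?hb'.
Qed.

Lemma validP (h : 'I_k) s : reflect
  (forall b : 'I_k, adj (pattern I) h b ->
     aG (fib h (top s)) (fib b (dig s (slot h b))) != 0) (validb h s).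
Proof.
rewrite /validb /invalid sum_nat_eq0; apply: (iffP forallP) => H b.
  by move=> hb; have := H b; rewrite /= aHE hb mul1n; case: aG.
by rewrite /= aHE; case hb: adj => //; rewrite mul1n; have := H b hb; case: aG.
Qed.

(** A colour-preserving homomorphism from pattern to host; it is injective because [color I] is a
    left inverse. *)
Definition hom (g : 'I_k -> 'I_(k * n)) : Prop :=
  (forall h, color I (g h) = h) /\
  (forall a b, adj (pattern I) a b -> adj (host I) (g a) (g b)).

(** Given a subgraph, invert the colouring on it. Conversely, the image of [g] with just the edges
    inherited from the pattern is a subgraph, since subgraphs need not be induced, and the colouring
    maps it isomorphically to the pattern. *)
Lemma csi_yesP : csi_yes I <-> exists g, hom g.
Proof.
split=> [[G' [inj onto iso]]|[g [gc gh]]].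
  have ex h : exists v, v \in sub_verts G' /\ color I v = h.
    have : h \in [set: 'I_k] by rewrite inE.
    by rewrite -onto => /imsetP[v vG ->]; exists v.
  have [g gP] := fin_all_exists ex.
  have gG h : g h \in sub_verts G' by case: (gP h).
  have gc h : color I (g h) = h by case: (gP h).
  exists g; split=> // a b ab.
  suff /(@sub_incl _ _ G')[] : sub_adj G' (g a) (g b) by [].
  by rewrite -iso // !gc.
pose V := g @: [set: 'I_k].
have VE v : v \in V -> v = g (color I v).
  by case/imsetP => h _ ->; rewrite gc.
pose r := [rel u v | [&& u \in V, v \in V &
  adj (pattern I) (color I u) (color I v)]].
have rs : symmetric r.
  by move=> u v; rewrite /r /= adj_sym; do 2!case: (_ \in V).
have ri u v : r u v -> [/\ adj (host I) u v, u \in V & v \in V].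
  by case/and3P => uV vV uv; split=> //; rewrite (VE u) // (VE v) // gh.
exists (Subgraph rs ri); split=> /= [u v uV vV E|| u v uV vV].
- by rewrite (VE u) // (VE v) // E.
- apply/setP => h; rewrite !inE; apply/imsetP; exists (g h) => //.
  by apply: imset_f.
- by rewrite uV vV.
Qed.

Lemma hom_selection g (w : 'I_k -> nat) : hom g ->
  (forall h, w h < n) -> (forall h : 'I_k, fib h (w h) = g h) ->
  forall h : 'I_k, exists s, [/\ s < nsel, top s = w h, validb h s &
    forall b : 'I_k, adj (pattern I) h b -> dig s (slot h b) = w b].
Proof.
move=> [gc gh] wn wg h.
(* The digit at position [j] is the rank of the image of the neighbour in that slot; [w h] is a
   default value below [n]. *)
pose w' j := if [pick b : 'I_k | adj (pattern I) h b && (slot h b == j)] is Some b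
  then w b else w h.
have [s [sn st sd]] : exists s, [/\ s < nsel, top s = w h &
    forall j, j < 3 -> dig s j = w' j].
  apply: selection_ex => // j _; rewrite /w'; case: pickP => // *; exact: wn.
have D (b : 'I_k) : adj (pattern I) h b -> dig s (slot h b) = w b.
  move=> hb; rewrite sd; last exact: slot_lt3.
  rewrite /w'; case: pickP => [c /andP[hc /eqP/slot_inj ->] //|].
  by move/(_ b); rewrite hb eqxx.
exists s; split=> //; apply/validP => b hb.
by rewrite st D // !wg aGE gh.
Qed.

Lemma hom_ranks g : hom g ->
  exists w : 'I_k -> nat, forall h : 'I_k, w h < n /\ fib h (w h) = g h.
Proof.
case=> gc _.
have ex h : exists i, i < n /\ fib (h : 'I_k) i = g h.
  by have [i lt E] := fib_surj (g h); exists i; rewrite gc in E.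
have [w wP] := fin_all_exists ex; by exists w.
Qed.

Lemma hom_not_stuck g : hom g -> stuck = 0.
Proof.
move=> hg; have [w wP] := hom_ranks hg.
apply/eqP/negPn/negP => /stuckP[h H].
have [||s [lt _ vs _]] := @hom_selection g w hg _ _ h.
- by move=> a; case: (wP a).
- by move=> a; case: (wP a).
by have /negP := H (Ordinal lt).
Qed.

Lemma code_inj i j i' j' : j < n -> i' < n ->
  i * n + j + 1 = j' * n + i' + 1 -> i = j' /\ j = i'.
Proof.
move=> lj li /eqP; rewrite eqn_add2r => /eqP E.
have n0 : 0 < n by lia.
split.
  have := congr1 (divn^~ n) E.
  by rewrite !divnMDl // !divn_small // !addn0.
have := congr1 (modn^~ n) E.
by rewrite !modnMDl !modn_small.
Qed.

(** Equal codes on an edge mean that the choices at both ends name the same two vertices. The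
    leading digits then define [g], and admissibility of the choices makes it a homomorphism.
    Conversely, choices recording the ranks of the images under [g] are admissible and have equal
    codes. *)
Lemma hom_codes : (exists g, hom g) <->
  stuck = 0 /\ exists s : 'I_k -> nat, (forall h, s h < nsel) /\
    forall a b : 'I_k, a < b -> adj (pattern I) a b ->
      lcode a b (pick a (s a)) = ucode b a (pick b (s b)).
Proof.
split=> [[g hg]|[st [s [sn sc]]]].
  split; first exact: hom_not_stuck hg.
  have [w wP] := hom_ranks hg.
  have [||s sP] := fin_all_exists (@hom_selection g w hg _ _).
  - by move=> a; case: (wP a).
  - by move=> a; case: (wP a).
  exists s; split=> [h|a b ltab ab]; first by case: (sP h).
  have [_ ta va da] := sP a; have [_ tb vb db] := sP b.
  by rewrite !pick_id // /lcode /ucode ta tb da // db // adj_sym.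
have vp (h : 'I_k) : validb h (pick h (s h)) by apply: pick_valid.
have tn (h : 'I_k) : top (pick h (s h)) < n by apply/top_lt/pick_lt.
have ex (h : 'I_k) : exists v : 'I_(k * n),
    color I v = h /\ fib h (top (pick h (s h))) = v.
  by have [v vc ve] := fib_color h (tn h); exists v.
have [g gP] := fin_all_exists ex.
have gc h : color I (g h) = h by case: (gP h).
have ge (h : 'I_k) : fib h (top (pick h (s h))) = g h by case: (gP h).
have lt_hom (a b : 'I_k) : a < b -> adj (pattern I) a b -> adj (host I) (g a) (g b).
  move=> ltab ab; have n0 : 0 < n by have := tn a; lia.
  (* The choice of [a] assigns to [b] the leading digit of the choice of [b], so its admissibility
     speaks of [g a] and [g b]. *)
  have [_ D] := code_inj (dig_lt _ _ n0) (tn b) (sc a b ltab ab).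
  by have := validP _ _ (vp a) b ab; rewrite D !ge aGE; case: adj.
exists g; split=> // a b ab; case: (ltngtP a b) => [|ltba|E].
- by move/lt_hom; apply.
- by rewrite adj_sym lt_hom // adj_sym.
- by move: ab; rewrite (val_inj E) adj_irr.
Qed.

(** * The vector instance, its restrictedness and its equivalence *)

Definition entry (h : 'I_k) (s : nat) (p : 'I_k * 'I_k) : int :=
  let z := Posz (mag h s p.1 p.2) in
  (if sgn h p.2 == 0 then z else - z)%R.

Definition row_of (h : 'I_k) (s : nat) : 'rV[int]_#|edges (pattern I)| :=
  (\row_j entry h s (arc j))%R.

Definition sum_instance : vksum_instance #|edges (pattern I)| k :=
  VKSum (fun h => [seq row_of h s | s <- iota 0 nsel]) 0%R.

Lemma entry_lower (a b : 'I_k) s : a != b ->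
  entry a s (a, b) = Posz (lcode a b (pick a s)).
Proof.
move=> /negbTE ne; rewrite -val_eqE /= in ne.
by rewrite /entry /sgn /mag /= !eqNE eqxx ne !mul0n addn0 mul1n.
Qed.

Lemma entry_upper (a b : 'I_k) s : a != b ->
  entry b s (a, b) = (if stuck == 0 then - Posz (ucode b a (pick b s))
    else Posz (ucode b a (pick b s)))%R.
Proof.
rewrite eq_sym => /negbTE ne; rewrite -val_eqE /= in ne.
rewrite /entry /sgn /mag /= !eqNE eqxx ne mul0n add0n !mul1n.
by case: (stuck) => [|m]; rewrite ?subn0 ?subSS ?sub0n.
Qed.

Lemma entry_other (h a b : 'I_k) s : a != h -> b != h -> entry h s (a, b) = 0%R.
Proof.
rewrite !(eq_sym _ h) => /negbTE na /negbTE nb; rewrite -!val_eqE /= in na nb.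
by rewrite /entry /sgn /mag /= !eqNE na nb !mul0n.
Qed.

Lemma code_bounds i j : i < n -> j < n -> 0 < i * n + j + 1 <= n ^ 2.
Proof. by move=> li lj; rewrite -mulnn; nia. Qed.

Lemma lcode_bounds h b s : s < nsel -> 0 < lcode h b s <= n ^ 2.
Proof.
move=> lt; have tn := top_lt lt.
by apply: code_bounds => //; apply: dig_lt; lia.
Qed.

Lemma ucode_bounds h b s : s < nsel -> 0 < ucode h b s <= n ^ 2.
Proof.
move=> lt; have tn := top_lt lt.
by apply: code_bounds => //; apply: dig_lt; lia.
Qed.

(** Defined through incidence rather than read off the lists, which are empty for [n = 0]. Once a
    list is stuck, the dimensions of upper ends become positive too. *)
Definition positive_dims (h : 'I_k) : {set 'I_#|edges (pattern I)|} :=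
  [set j | ((arc j).1 == h) || ((arc j).2 == h) && (stuck != 0)].
Definition negative_dims (h : 'I_k) : {set 'I_#|edges (pattern I)|} :=
  [set j | ((arc j).2 == h) && (stuck == 0)].

Lemma dims_incident h :
  positive_dims h :|: negative_dims h = [set j | incident h j].
Proof.
apply/setP => j; rewrite !inE /incident.
by case: eqP => //= _; case: eqP => //= _; case: eqP.
Qed.

Lemma dims_disjoint h : [disjoint positive_dims h & negative_dims h].
Proof.
apply/pred0P => j; rewrite /= !inE; have := arc_neq j.
case: (arc j) => a b /=; case: (a =P h) => [->|_] /= ne.
  by rewrite (eq_sym b) (negbTE ne).
by case: (b == h) => //=; case: (stuck == 0).
Qed.

Lemma nselE : nsel = n ^ 4.
Proof. by rewrite /nsel !expnS expn0 muln1 !mulnA. Qed.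

Lemma sum_instance_restricted : restricted n sum_instance.
Proof.
split=> [//|h|]; first by rewrite size_map size_iota nselE.
exists positive_dims, negative_dims; split=> [h|j]; last first.
  rewrite -(card_ends j); apply: eq_card => h.
  by rewrite inE dims_incident !inE.
split; first exact: dims_disjoint.
  have := cardsUI (positive_dims h) (negative_dims h).
  have /eqP -> : positive_dims h :&: negative_dims h == set0.
    by rewrite setI_eq0 dims_disjoint.
  by rewrite cards0 addn0 => <-; rewrite dims_incident card_incident.
move=> v j /mapP[s]; rewrite mem_iota /= => lt ->; rewrite mxE.
have := arc_neq j; rewrite dims_incident !inE /incident.
have lp := pick_lt h lt.
case: (arc j) => a b /= ne.
have := lcode_bounds h b lp; have := ucode_bounds h a lp.
case: (a =P h) ne => [-> ne|/eqP na ne] hu hl.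
  rewrite (entry_lower _ ne) (eq_sym b) (negbTE ne) /=.
  by split=> // _; rewrite !lez_nat.
case: (b =P h) ne => [-> ne|/eqP nb ne] /=; last first.
  by rewrite (entry_other _ na nb).
rewrite (entry_upper _ ne); split=> //.
  by move/negbTE ->; rewrite !lez_nat.
by move=> ->; move: hu; lia.
Qed.

(** Only the two ends of an edge contribute to its coordinate. If no list is stuck, the sum there is
    the difference of the two codes; otherwise it is a sum of positive numbers. *)
Lemma sum_instance_yesP : csi_yes I <-> vksum_yes sum_instance.
Proof.
rewrite csi_yesP hom_codes.
have colsum (s : 'I_k -> nat) j :
    ((\sum_h row_of h (s h)) ord0 j =
      entry (arc j).1 (s (arc j).1) (arc j) +
      entry (arc j).2 (s (arc j).2) (arc j))%R.
  have := arc_neq j; rewrite summxE (bigD1 (arc j).1) //=.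
  move=> ne; rewrite (bigD1 (arc j).2) 1?eq_sym //= big1 ?GRing.addr0 ?mxE //.
  move=> h /andP[n1 n2]; rewrite mxE; case: (arc j) n1 n2 => a b /= n1 n2.
  by apply: entry_other; rewrite eq_sym.
split=> [[st [s [sn sc]]]|[a [al az]]].
  exists (fun h => row_of h (s h)); split=> [h|].
    by apply: map_f; rewrite mem_iota /= add0n.
  apply/rowP => j; rewrite colsum mxE.
  have := arc_neq j; have := arc_mem j.
  case: (arc j) => a b /= [lt ab] ne.
  by rewrite entry_lower // entry_upper // st eqxx sc // GRing.subrr.
have ex h : exists s, s < nsel /\ a h = row_of h s.
  by have /mapP[s] := al h; rewrite mem_iota /= => lt ->; exists s.
have [s sP] := fin_all_exists ex.
have sn h : s h < nsel by case: (sP h).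
have {}az : (\sum_h row_of h (s h) = 0)%R.
  by rewrite -[RHS]az; apply: eq_bigr => h _; case: (sP h).
have col0 (b c : 'I_k) : b < c -> adj (pattern I) b c ->
    (entry b (s b) (b, c) + entry c (s c) (b, c) = 0)%R.
  move=> lt bc; have [j jE] := arc_surj lt bc.
  by have := colsum s j; rewrite az mxE jE.
have ne (b c : 'I_k) : b < c -> b != c by move=> lt; rewrite neq_ltn lt.
have [st|st] := eqVneq stuck 0.
  split=> //; exists s; split=> // b c lt bc.
  have := col0 b c lt bc; rewrite entry_lower ?ne // entry_upper ?ne //.
  by rewrite st eqxx => /eqP; rewrite GRing.subr_eq0 => /eqP [].
have [h _] := stuckP st.
(* A stuck list provides a vertex and cubicity a neighbour, so there is an edge whose coordinate
   cannot vanish. *)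
have [b hb] : exists b, adj (pattern I) h b.
  have : 0 < #|[set y | adj (pattern I) h y]| by rewrite cub.
  by case/card_gt0P => b; rewrite inE; exists b.
have [b' [c' [lt bc]]] :
    exists b c : 'I_k, b < c /\ adj (pattern I) b c.
  case: (ltngtP h b) => [lt|gt|E].
  - by exists h, b.
  - by exists b, h; rewrite adj_sym.
  - by move: hb; rewrite (val_inj E) adj_irr.
have := col0 b' c' lt bc; rewrite entry_lower ?ne // entry_upper ?ne //.
rewrite (negbTE st); have := lcode_bounds b' c' (pick_lt b' (sn b')).
by lia.
Qed.

(** The loop over [i] runs at most once: it is a conditional keeping the pairs [a < b] that are
    edges, in the order of [arcs]. *)
Definition output : seq nat :=
  [:: 3 * k %/ 2] ++ [:: k] ++
  flatten [seq [:: 0] ++ [:: 0] | j <- iota 0 (3 * k %/ 2)] ++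
  flatten [seq [:: nsel] ++
    flatten [seq
      flatten [seq
        flatten [seq
          flatten [seq [:: sgn h b] ++ [:: mag h s a b]
            | i <- iota 0 (ltN a b * aH a b)]
          | b <- iota 0 k]
        | a <- iota 0 k]
      | s <- iota 0 nsel]
    | h <- iota 0 k].

(** The flag must agree with the actual sign, so a flagged zero has to be excluded: the flag is set
    only at the upper end, where the code is at least 1. *)
Lemma encode_entry h s (a b : 'I_k) : a < b ->
  encode_int (entry h s (a, b)) = [:: sgn h b; mag h s a b].
Proof.
move=> lt; rewrite /entry /=; case: eqP => [-> //|].
rewrite /sgn eqNE; case: eqP => //= hb; rewrite mul1n => st.
have -> : 1 - stuck = 1 by lia.
have : 0 < mag h s a b by rewrite /mag hb (eqNE b b) eqxx mul1n /ucode; lia.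
by case: mag.
Qed.

Lemma encode_row h s : encode_vec (row_of h s) =
  flatten [seq
    flatten [seq
      flatten [seq [:: sgn h b] ++ [:: mag h s a b]
        | i <- iota 0 (ltN a b * aH a b)]
      | b <- iota 0 k]
    | a <- iota 0 k].
Proof.
rewrite /encode_vec.
under eq_map do rewrite mxE.
rewrite (map_arc _ (fun p => encode_int (entry h s p))) /arcs.
rewrite flatten_map_filter flatten_map_allpairs [in RHS]map_iota_ord.
congr flatten; apply: eq_map => a /=.
rewrite map_iota_ord; congr flatten; apply: eq_map => b /=.
rewrite ltNE aHE; case: ltnP => //= lt; case: adj => //.
by rewrite encode_entry.
Qed.

Lemma encode_sum_instance : encode_vksum sum_instance = output.
Proof.
have mE : 3 * k %/ 2 = #|edges (pattern I)| by rewrite -(handshake cub) mulKn.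
rewrite /encode_vksum /output mE /=; congr [:: _, _ & _]; congr (_ ++ _).
  rewrite /encode_vec [in RHS]map_iota_ord; congr flatten.
  by apply: eq_map => j; rewrite mxE.
rewrite [in RHS]map_iota_ord; congr flatten.
apply: eq_map => h /=; rewrite /encode_list /= size_map size_iota -map_comp.
by congr (_ :: flatten _); apply: eq_map => s; rewrite /= encode_row.
Qed.

End Reduction.

(** * The reduction as a program *)

Declare Scope term_scope.
Delimit Scope term_scope with T.
Bind Scope term_scope with term.
Notation "a + b" := (TOp Add a b) : term_scope.
Notation "a - b" := (TOp Defs.Sub a b) : term_scope.
Notation "a * b" := (TOp Mul a b) : term_scope.
Notation "a / b" := (TOp Div a b) : term_scope.
Notation "# c" := (TConst c) (at level 2, c at level 0, format "# c") : term_scope.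
Notation "$ i" := (TVar i) (at level 2, i at level 0, format "$ i") : term_scope.

Local Open Scope term_scope.

Definition t_k : term := TIn #0.
Definition t_n : term := TIn #1.
Definition t_pattern (a b : term) : term := TIn (#2 + (a * t_k + b)).
Definition t_host (u v : term) : term :=
  TIn (#2 + (t_k * t_k + (u * (t_k * t_n) + v))).
Definition t_color (v : term) : term :=
  TIn (#2 + (t_k * t_k + (t_k * t_n * (t_k * t_n) + v))).
Definition t_eq (a b : term) : term := #1 - ((a - b) + (b - a)).
Definition t_lt (a b : term) : term := #1 - (#1 + a - b).
(** Bound variables are numbered by hand, apart from the free variables of the arguments placed
    under them, because these macros do not rename to avoid capture. *)
Definition t_fib (h i : term) : term :=
  TSum 10 (t_k * t_n)
    ($10 * (t_eq (t_color $10) h * t_eq (TSum 11 $10 (t_eq (t_color $11) h)) i)).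
Definition t_slot (h b : term) : term := TSum 12 b (t_pattern h $12).
Definition t_weight (j : term) : term :=
  t_eq j #0 + (t_eq j #1 * t_n + t_eq j #2 * (t_n * t_n)).
Definition t_dig (s j : term) : term :=
  s / t_weight j - s / t_weight j / t_n * t_n.
Definition t_top (s : term) : term := s / (t_n * t_n * t_n).
Definition t_invalid (h s : term) : term :=
  TSum 9 t_k (t_pattern h $9 *
    (#1 - t_host (t_fib h (t_top s)) (t_fib $9 (t_dig s (t_slot h $9))))).
Definition t_valid (h s : term) : term := #1 - t_invalid h s.
Definition t_nsel : term := t_n * t_n * t_n * t_n.
Definition t_first_valid (h : term) : term :=
  TSum 5 t_nsel ($5 * (t_valid h $5 * t_eq (TSum 6 $5 (t_valid h $6)) #0)).
Definition t_stuck : term :=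
  TSum 7 t_k (t_eq (TSum 8 t_nsel (t_valid $7 $8)) #0).
Definition t_pick (h s : term) : term :=
  t_valid h s * s + (#1 - t_valid h s) * t_first_valid h.
Definition t_lcode (h b s : term) : term :=
  t_top s * t_n + t_dig s (t_slot h b) + #1.
Definition t_ucode (h b s : term) : term :=
  t_dig s (t_slot h b) * t_n + t_top s + #1.
Definition t_sgn (h b : term) : term := t_eq h b * (#1 - t_stuck).
Definition t_mag (h s a b : term) : term :=
  t_eq h a * t_lcode h b (t_pick h s) + t_eq h b * t_ucode h a (t_pick h s).

Definition reduction : outp :=
  OSeq (OWrite (#3 * t_k / #2))
  (OSeq (OWrite t_k)
  (OSeq (OFor 0 (#3 * t_k / #2) (OSeq (OWrite #0) (OWrite #0)))
  (OFor 0 t_k (OSeq (OWrite t_nsel)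
    (OFor 1 t_nsel (OFor 2 t_k (OFor 3 t_k
      (OFor 4 (t_lt $2 $3 * t_pattern $2 $3)
        (OSeq (OWrite (t_sgn $0 $3)) (OWrite (t_mag $0 $1 $2 $3))))))))))).

Local Close Scope term_scope.

(** * Reading the instance off its encoding *)

Section Input.
Variable x : seq nat.
Let k := nth 0 x 0.
Let n := nth 0 x 1.

(** The tables follow the two header entries, adjacency matrices being stored row by row. *)
Definition in_pattern (a b : nat) : nat := nth 0 x (2 + (a * k + b)).
Definition in_host (u v : nat) : nat :=
  nth 0 x (2 + (k * k + (u * (k * n) + v))).
Definition in_color (v : nat) : nat :=
  nth 0 x (2 + (k * k + (k * n * (k * n) + v))).

(** The terms mirror the numerical definitions one by one, so both sides are convertible. *)
Lemma oden_reduction :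
  oden x (fun=> 0) reduction = output k n in_pattern in_host in_color.
Proof. by []. Qed.

End Input.

Section Encoding.
Variables (k n : nat) (I : csi_instance k n).
Let x := encode_csi I.

Lemma size_encode_adj N (G : sgraph 'I_N) : size (encode_adj G) = N * N.
Proof. by rewrite size_allpairs size_enum_ord. Qed.

Lemma nth_encode_adj N (G : sgraph 'I_N) (u v : 'I_N) :
  nth 0 (encode_adj G) (u * N + v) = adj G u v.
Proof.
rewrite /encode_adj -[X in (_ * X + _)%N](size_enum_ord N).
by rewrite (nth_allpairs _ u v) ?size_enum_ord // !nth_ord_enum.
Qed.

Lemma index_lt N (u v : 'I_N) : u * N + v < N * N.
Proof. by have := ltn_ord u; have := ltn_ord v; nia. Qed.

Lemma in_patternE (a b : 'I_k) : in_pattern x a b = adj (pattern I) a b.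
Proof.
by rewrite /in_pattern /= add0n nth_cat size_encode_adj index_lt nth_encode_adj.
Qed.

Lemma in_hostE (u v : 'I_(k * n)) : in_host x u v = adj (host I) u v.
Proof.
rewrite /in_host /= add0n nth_cat size_encode_adj ltnNge leq_addr /= addKn.
by rewrite nth_cat size_encode_adj index_lt nth_encode_adj.
Qed.

Lemma in_colorE (v : 'I_(k * n)) : in_color x v = color I v.
Proof.
rewrite /in_color /= add0n nth_cat size_encode_adj ltnNge leq_addr /= addKn.
rewrite nth_cat size_encode_adj ltnNge leq_addr /= addKn.
by rewrite (nth_map v) ?size_enum_ord // nth_ord_enum.
Qed.

Lemma size_le_bitsize (s : seq nat) : size s <= bitsize s.
Proof.
by rewrite /bitsize; elim: s => //= v s IH; rewrite -add1n leq_add.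
Qed.

(** For positive [k] the length of the encoding exceeds [k] and [n], and the other entries are bits
    or colours below [k]. Values, and not merely their bit lengths, are thus bounded by the input
    size. *)
Lemma encode_csi_bounded : 0 < k -> forall a, nth 0 x a <= bitsize x.
Proof.
move=> k0 a; apply: leq_trans (size_le_bitsize x).
have sx : size x = 2 + (k * k + (k * n * (k * n) + k * n)).
  by rewrite /x /encode_csi !size_cat !size_encode_adj size_map size_enum_ord.
have [lt|ge] := ltnP a (size x); last by rewrite nth_default.
have := mem_nth 0 lt; move: (nth 0 x a) => v; rewrite sx.
rewrite !inE !mem_cat => /or4P[/eqP->|/eqP->|/allpairsP[p [_ _ ->]]|].
- by nia.
- by nia.
- by case: adj; lia.
case/orP => [/allpairsP[p [_ _ ->]]|/mapP[w _ ->]]; first by case: adj; lia.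
by have := ltn_ord (color I w); nia.
Qed.

End Encoding.

Lemma bits0 : bits 0 = 1.
Proof. by []. Qed.

(** For positive [N] the base [N + 2] is at most [3 * N], which gives the factor [3 ^ d]; the
    constant 10 absorbs [N + 3], a bound on the cost of the initial test. *)
Lemma regroup_bound N d : 0 < N ->
  (N + 2) ^ d + (N + 3) <= (3 ^ d + 10) * N ^ d.+1 + (3 ^ d + 10).
Proof.
move=> N0.
have H1 : (N + 2) ^ d <= 3 ^ d * N ^ d.+1.
  apply: leq_trans (_ : (3 * N) ^ d <= _).
    by case: d => // d; rewrite leq_exp2r //; lia.
  by rewrite expnMn leq_mul2l leq_pexp2l ?orbT.
have H2 : N <= N ^ d.+1 by rewrite -{1}(expn1 N) leq_pexp2l.
by rewrite mulnDl; lia.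
Qed.

(* For [k = 0] the value [n] is not bounded by the length of the input, hence
   the separate branch. *)
Definition reduction_prog : prog :=
  If (In (Const 0)) (ocomp reduction 0) (Seq (Write (Const 0)) (Write (Const 0))).

Theorem theorem4p4 :
  exists (P : prog) (c d : nat),
  forall (k n : nat) (I : csi_instance k n),
  cubic (pattern I) ->
  let m := #|edges (pattern I)| in
  2 * m = 3 * k /\
  exists J : vksum_instance m k,
    [/\ restricted n J,
        csi_yes I <-> vksum_yes J
      & outputs_within P (encode_csi I) (encode_vksum J)
          (c * bitsize (encode_csi I) ^ d + c)].
Proof.
have [d Hd] := ocomp_outputs reduction.
exists reduction_prog, (3 ^ d + 10), d.+1 => k n I cub m.
split; first exact: handshake.
set x := encode_csi I.
have HE := in_patternE I; have GE := in_hostE I; have CE := in_colorE I.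
exists (sum_instance (in_pattern x) (in_host x) (in_color x) I); split.
- exact: sum_instance_restricted.
- exact: sum_instance_yesP.
rewrite encode_sum_instance //.
have [k0|k0] := posnP k.
  subst k.
  (* The total is 7: three for the test and two for each write, within the additive constant. *)
  exists (cost x (fun=> 0) (In (Const 0)) +
    ((cost x (fun=> 0) (Const 0) + bits 0) + (cost x (fun=> 0) (Const 0) + bits 0))).
  exists (fun=> 0); split; first by rewrite /x /= !bits0; lia.
  apply: exec_if => /=; apply: exec_seq; exact: exec_write.
have N0 : 0 < bitsize x by apply: leq_trans (size_le_bitsize x).
(* Adding 2 to the input size ensures a base of at least 2. *)
have [a|t [mu [T E]]] := Hd (bitsize x + 2) x (leq_addl _ _).
  by apply: leq_trans (leq_addr _ _); exact: encode_csi_bounded.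
exists (cost x (fun=> 0) (In (Const 0)) + t), mu; split; last first.
  rewrite oden_reduction in E.
  by apply: exec_if; rewrite /= -lt0n k0; exact: E.
apply: leq_trans (regroup_bound d N0).
have kB : k <= bitsize x := encode_csi_bounded I k0 0.
have -> : cost x (fun=> 0) (In (Const 0)) = 2 + bits k by [].
by have := bits_le k; lia.
Qed.
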